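(* Let $N\ge 1$ be an integer and let $f_k$ be a swing leg kernel, i.e. a continuous and increasing function giving the step length $l=f_k(\tau)$ of a step that takes a time interval $\tau\in[0,\tau_{max}]$, where $\tau_{max}=f_k^{-1}(l_{max})$ and $l_{max}$ is the maximum normalized step length. For $\tau_1,\dots,\tau_N\in[0,\tau_{max}]$ put $$d_N(\tau_1,\dots,\tau_N)=\sum_{i=1}^N\left(\sum_{j=1}^i(-1)^{i+j}f_k(\tau_j)\right)\exp\left(-\sum_{j=1}^i\tau_j\right).$$ Consider the one-dimensional dimensionless linear inverted pendulum model standing at $x=0$ at time $0$, in a state whose instantaneous capture point at time $0$ is $x_{ic}(0)=d$. Then the state is $N$-step capturable with swing leg kernel $f_k$ if and only if the equation $d=d_N(\tau_1,\dots,\tau_N)$ has a real solution $\tau_1,\dots,\tau_N\in[0,\tau_{max}]$. The $\tau_i$ are the time-margins. The $l_i=f_k(\tau_i)$, $i=1,\dots,N$, given by such $\tau_i$ are a sequence of $N$-step capture points. Existence of such $\tau_i$ is also equivalent to $$d\le\max_{\tau_1,\dots,\tau_N\in[0,\tau_{max}]}d_N(\tau_1,\dots,\tau_N).$$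
   Context: Model (dimensionless, one horizontal axis): the center of mass position $x(t)\in\mathbb{R}$ satisfies $\ddot x = x - p$, where $p\in\mathbb{R}$ is the current (point) stance foot location, constant between steps. The instantaneous capture point is $x_{ic}=x+\dot x$, so $\dot x_{ic}=x_{ic}-p$. A step instantaneously changes the stance foot location $p$, with $x$ and $\dot x$ continuous. The robot is captured if, with the stance foot kept at its current location for all later times, it comes to rest without falling ($\dot x(s)\to 0$ and $x(s)$ converges as $s\to\infty$). At time $0$ a push disturbance acts on the robot, after which the instantaneous capture point is at $x_{ic}(0)=d$. Step pattern: the two legs step alternately and the length of a step is the displacement of the swing foot. Initially both feet are at $x=0$. Given $\tau_1,\dots,\tau_N\in[0,\tau_{max}]$, put $T_0=0$, $T_i=\tau_1+\dots+\tau_i$, $p_{-1}=p_0=0$ and $p_i=p_{i-2}+f_k(\tau_i)$ for $1\le i\le N$. The stance foot is at $p_{i-1}$ during $[T_{i-1},T_i]$ for $1\le i\le N$ and at $p_N$ from time $T_N$ on. The state at time $0$ is $N$-step capturable with swing leg kernel $f_k$ if there are $\tau_1,\dots,\tau_N\in[0,\tau_{max}]$ such that this sequence of $N$ steps captures the robot; such $\tau_i$ are called time-margins. The places stepped to, specified by the step lengths $l_1,\dots,l_N$, are called a sequence of $N$-step capture points if, for each $i$, the $i$-th step (of length $l_i$, taken at time $T_i$) drives the robot to a state that is captured by the remaining $N-i$ steps (to a captured state when $i=N$).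
   Formalization: The final equivalence with d ≤ max d_N is stated only for f_k(0)=0 (a zero-time step has zero length) and d≥0; without these it fails: for f_k(τ)=τ every d_N≥0, so d=-1 is below the maximum but is not a value, and if f_k(0)>0 then d=0 is not a value. *)

(* Defs.v *)
From HB Require Import structures.
From mathcomp Require Import all_boot all_order all_algebra.
From mathcomp Require Import all_classical all_reals all_analysis.

Set Implicit Arguments.
Unset Strict Implicit.
Unset Printing Implicit Defensive.

Import Order.TTheory GRing.Theory Num.Theory.
Import numFieldNormedType.Exports.

Local Open Scope classical_set_scope.
Local Open Scope ring_scope.

(* Sequences are indexed from 0: tau`_i and l`_i are the duration and the
   length of the (i+1)-st step. *)

Record lip_state (R : realType) := LipState {
  com : R;
  vel : R;
  stance : R;
  swing : R
}.

Definition capture_point (R : realType) (s : lip_state R) : R := com s + vel s.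

(* Only [0, taumax] matters: f is arbitrary outside this interval.
   The last condition is taumax = f^-1(lmax). *)
Definition swing_leg_kernel (R : realType) (f : R -> R) (lmax taumax : R) :
    Prop :=
  [/\ 0 <= taumax,
      {within `[0, taumax], continuous f},
      {in `[0, taumax] &, {homo f : x y / x < y}} &
      f taumax = lmax].

(* T_k = tau_1 + ... + tau_k, the instant of the k-th step. *)
Definition step_time (R : realType) (tau : seq R) (k : nat) : R :=
  \sum_(j < k) tau`_j.

(* foothold s l k is the foot location p_(k-1):
   p_(-1) is the swing foot, p_0 the stance foot, p_i = p_(i-2) + l_i. *)
Fixpoint foothold (R : realType) (s : lip_state R) (l : seq R) (k : nat) : R :=
  match k with
  | 0 => swing s
  | 1 => stance s
  | k'.+2 => foothold s l k' + l`_k'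
  end.

(* x'' = x - p on the interval I, with v = x'. *)
Definition lip_dynamics (R : realType) (p : R) (I : set R) (x v : R -> R) :
    Prop :=
  forall t, I t -> is_derive t 1 x (v t) /\ is_derive t 1 v (x t - p).

(* x and v are continuous on [0, +oo[; the equation of motion is imposed on the
   open phases between steps, since x'' jumps when the stance foot changes.
   A phase of zero duration imposes nothing. *)
Definition motion (R : realType) (s : lip_state R) (tau l : seq R)
    (x v : R -> R) : Prop :=
  [/\ x 0 = com s /\ v 0 = vel s,
      {within `[0, +oo[, continuous x} /\ {within `[0, +oo[, continuous v},
      (forall k, (k < size tau)%N ->
        lip_dynamics (foothold s l k.+1)
          `]step_time tau k, step_time tau k.+1[ x v) &
      lip_dynamics (foothold s l (size tau).+1)
        `]step_time tau (size tau), +oo[ x v].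

(* After the last step the stance foot is kept for ever, so this says that the
   steps lead to a captured state; captured_by s [::] [::] says that s itself
   is captured. *)
Definition captured_by (R : realType) (s : lip_state R) (tau l : seq R) :
    Prop :=
  exists x v : R -> R,
    [/\ motion s tau l x v,
        v t @[t --> +oo] --> (0 : R) &
        cvg (x t @[t --> +oo])].

Definition admissible_times (R : realType) (taumax : R) (tau : seq R) : Prop :=
  forall t, t \in tau -> 0 <= t <= taumax.

Definition time_margins (R : realType) (f : R -> R) (taumax : R)
    (s : lip_state R) (tau : seq R) : Prop :=
  admissible_times taumax tau /\ captured_by s tau (map f tau).

Definition N_step_capturable (R : realType) (f : R -> R) (taumax : R) (N : nat)
    (s : lip_state R) : Prop :=
  exists tau : N.-tuple R, time_margins f taumax s tau.

(* The state just after the k-th step (k >= 1), the clock being reset: the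
   stance foot is p_k and the foot that moves next is at p_(k-1). *)
Definition state_after_step (R : realType) (s : lip_state R) (tau l : seq R)
    (x v : R -> R) (k : nat) : lip_state R :=
  LipState (x (step_time tau k)) (v (step_time tau k))
    (foothold s l k.+1) (foothold s l k).

Definition capture_points (R : realType) (s : lip_state R) (tau l : seq R) :
    Prop :=
  exists x v : R -> R,
    motion s tau l x v /\
    forall k, (0 < k <= size tau)%N ->
      captured_by (state_after_step s tau l x v k) (drop k tau) (drop k l).

(* The sign (-1)^(i+j) is not affected by indexing from 0. *)
Definition d_ (R : realType) (f : R -> R) (N : nat) (tau : N.-tuple R) : R :=
  \sum_(i < N) (\sum_(j < i.+1) (-1) ^+ (i + j) * f tau`_j)
               * expR (- \sum_(j < i.+1) tau`_j).

Definition is_maximum (R : realType) (A : set R) (M : R) : Prop :=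
  A M /\ ubound A M.

(* Main.v *)
Require Import Defs.
From HB Require Import structures.
From mathcomp Require Import all_boot all_order all_algebra.
From mathcomp Require Import all_classical all_reals all_analysis.
From mathcomp Require Import ring lra.

Set Implicit Arguments.
Unset Strict Implicit.
Unset Printing Implicit Defensive.

Import Order.TTheory GRing.Theory Num.Theory.
Import numFieldNormedType.Exports.

Local Open Scope classical_set_scope.
Local Open Scope ring_scope.

(* The capture point c = x + v satisfies c' = c - p, so that c(t) exp(-t)
   changes by p_k (exp(-T_(k+1)) - exp(-T_k)) during the phase on foot p_k.
   After the last step c - p_N is multiplied by exp(t - T_N) and x - v - p_N by
   exp(T_N - t): the robot is captured iff c(T_N) = p_N.  Summation by parts
   turns this condition into d = sum_k (p_k - p_(k-1)) exp(-T_k), and since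
   p_k - p_(k-1) = l_k - (p_(k-1) - p_(k-2)) the jumps of the stance foot are
   the alternating sums in d_N.  The maximum of d_N exists by compactness, and
   the values between 0 and the maximum are attained on the segment joining the
   zero tuple to a maximizer. *)

(* The case e = 1 is the diverging component, e = -1 the converging one. *)
Lemma lip_phase (R : realType) (p e a b : R) (x v : R -> R) :
  e ^+ 2 = 1 -> a <= b ->
  {within `[a, b], continuous x} -> {within `[a, b], continuous v} ->
  lip_dynamics p `]a, b[ x v ->
  x b + e * v b - p = (x a + e * v a - p) * expR (e * (b - a)).
Proof.
move=> e2 ab xc vc dyn.
(* [h] is constant on the phase: its derivative is [expR (- (e * t))] times v + e(x - p) - e(x + ev
   - p), that is (1 - e^2) v, which is 0. *)
pose h t := (x t + e * v t - p) * expR (- (e * t)).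
have dh t : t \in `]a, b[%R -> is_derive t 1 h 0.
  move=> tab; have [dx dv] : is_derive t 1 x (v t) /\ is_derive t 1 v (x t - p).
    exact: dyn.
  have -> : h = (x + e \*: v - cst p) * (expR \o (- (e \*: id))).
    by apply/funext.
  apply: is_derive_eq; rewrite /GRing.scale/=.
  by rewrite -[(_ - cst p) t]/(x t + e * v t - p); ring: e2.
have ch : {within `[a, b], continuous h}.
  move=> t; apply: cvgM.
    apply: cvgB; last exact: cvg_cst.
    by apply: cvgD; [exact: xc|apply: cvgM; [exact: cvg_cst|exact: vc]].
  apply: (@continuous_subspaceT _ _ `[a, b] (fun t => expR (- (e * t)))) => u.
  apply: (@continuous_comp _ _ _ (fun u => - (e * u)) expR).
    by apply: cvgN; apply: cvgM; [exact: cvg_cst|exact: cvg_id].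
  exact: continuous_expR.
(* The derivative is required only inside the phase, and a = b is allowed, so phases of zero
   duration are covered. *)
have [c _] := MVT_segment ab dh ch.
rewrite mul0r => /eqP; rewrite subr_eq0 => /eqP hba.
have -> : e * (b - a) = e * b - e * a by ring.
rewrite expRD mulrCA -[_ * expR (- (e * a))]/(h a) -hba /h mulrCA -expRD.
by rewrite subrr expR0 mulr1.
Qed.

(** * Step instants, and the capture point along a motion *)

Lemma step_timeS (R : realType) (tau : seq R) k :
  step_time tau k.+1 = step_time tau k + tau`_k.
Proof. by rewrite /step_time big_ord_recr. Qed.

Lemma step_time0 (R : realType) (tau : seq R) : step_time tau 0 = 0.
Proof. by rewrite /step_time big_ord0. Qed.

Lemma step_time_le (R : realType) (tau : seq R) :
  {in tau, forall t, 0 <= t} ->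
  {homo step_time tau : j k / (j <= k)%N >-> j <= k}.
Proof.
move=> tau0; apply: homo_leq => // [? ? ?|k]; first exact: le_trans.
rewrite step_timeS lerDl; have [kt|kt] := ltnP k (size tau).
  by apply: tau0; exact: mem_nth.
(* Past the end of the list the default entry is 0, so the step times become stationary. *)
by rewrite nth_default.
Qed.

Lemma step_time_ge0 (R : realType) (tau : seq R) k :
  {in tau, forall t, 0 <= t} -> 0 <= step_time tau k.
Proof. by move=> tau0; rewrite -(step_time0 tau) step_time_le. Qed.

(** Discounting by [expR (- step_time tau k)] cancels the exponential growth, so that each phase
    adds only a term in its own foothold. The shift [j.+1] is there because [foothold] starts at
    p_(-1). *)
Lemma motion_capture_point (R : realType) (s : lip_state R) (tau l : seq R)
    (x v : R -> R) (k : nat) :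
  {in tau, forall t, 0 <= t} -> motion s tau l x v -> (k <= size tau)%N ->
  (x (step_time tau k) + v (step_time tau k)) * expR (- step_time tau k) =
  capture_point s + \sum_(j < k) foothold s l j.+1 *
    (expR (- step_time tau j.+1) - expR (- step_time tau j)).
Proof.
move=> tau0 [[x0 v0] [xc vc] dyn _]; elim: k => [_|k IH kt].
  by rewrite step_time0 big_ord0 oppr0 expR0 mulr1 addr0 x0 v0.
have sub : `[step_time tau k, step_time tau k.+1] `<=` `[0, +oo[.
  move=> t /=; rewrite !in_itv/= andbT => /andP[kt' _].
  by rewrite (le_trans _ kt')// step_time_ge0.
have := lip_phase (expr1n _ 2) (step_time_le tau0 (leqnSn k))
  (continuous_subspaceW sub xc) (continuous_subspaceW sub vc) (dyn _ kt).
rewrite !mul1r expRD => /(canRL (subrK _)) ->.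
rewrite big_ord_recr /= addrA -(IH (ltnW kt)) (expRN (step_time tau k.+1)).
have := expR_gt0 (step_time tau k.+1); move: (expR (step_time tau k.+1)) => E E0.
by field; rewrite gt_eqF.
Qed.

(** After T both components follow [lip_phase] on the last foothold. The diverging one grows like
    exp(t - T), so convergence forces it to vanish; conversely, once it vanishes only the decaying
    one is left. *)
Lemma motion_captured (R : realType) (s : lip_state R) (tau l : seq R)
    (x v : R -> R) :
  let T := step_time tau (size tau) in
  {in tau, forall t, 0 <= t} -> motion s tau l x v ->
  (v t @[t --> +oo] --> (0 : R) /\ cvg (x t @[t --> +oo])) <->
  x T + v T = foothold s l (size tau).+1.
Proof.
move=> T tau0 [_ [xc vc] _ dyn]; set p := foothold _ _ _ in dyn *.
have T0 : 0 <= T by exact: step_time_ge0.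
have sol e t : e ^+ 2 = 1 -> T <= t ->
    x t + e * v t - p = (x T + e * v T - p) * expR (e * (t - T)).
  move=> e2 Tt; have sub : `[T, t] `<=` `[0, +oo[.
    by move=> u /=; rewrite !in_itv/= andbT => /andP[/(le_trans T0)].
  apply: lip_phase => //; [exact: continuous_subspaceW xc|
    exact: continuous_subspaceW vc|].
  by move=> u /=; rewrite in_itv/= => /andP[Tu _]; apply: dyn; rewrite /= in_itv/= Tu.
have decay : expR (T - t) @[t --> +oo] --> (0 : R).
  have -> : (fun t => expR (T - t)) = (fun t => expR T * expR (- t)).
    by apply/funext => t; rewrite expRD.
  rewrite -[X in _ --> X](mulr0 (expR T)).
  by apply: cvgM; [exact: cvg_cst|exact: cvgr_expR].
split=> [[v0 /cvg_ex[/= L xL]]|cT].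
  (* A convergent factor times a vanishing one tends to 0; yet by [sol] this product is constant for
     t >= T, so its constant value is 0. *)
  have : (x t + v t - p) * expR (T - t) @[t --> +oo] --> (0 : R).
    rewrite -[X in _ --> X](mulr0 (L + 0 - p)); apply: cvgM => //.
    by apply: cvgB; [exact: cvgD|exact: cvg_cst].
  have : (x t + v t - p) * expR (T - t) @[t --> +oo] --> x T + v T - p.
    apply: cvg_near_cst; near=> t.
    have Tt : T <= t by near: t; apply: nbhs_pinfty_ge; exact: num_real.
    have := sol 1 t (expr1n _ _) Tt; rewrite !mul1r => ->; rewrite -mulrA -expRD.
    have -> : t - T + (T - t) = 0 by ring.
    by rewrite expR0 mulr1.
  move=> A B; apply/eqP; rewrite -subr_eq0; apply/eqP.
  exact: (cvg_unique (@norm_hausdorff _ R) A B).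
have xv t : T <= t -> x t + v t = p.
  move=> Tt; have := sol 1 t (expr1n _ _) Tt.
  by rewrite !mul1r cT subrr mul0r => /eqP; rewrite subr_eq0 => /eqP.
have n1 : (-1) ^+ 2 = 1 :> R by rewrite sqrrN expr1n.
(* Half the converging component at T: together with x + v = p, the case e = -1 of [sol] gives -2v =
   2K exp(T - t). *)
pose K := (x T - v T - p) / 2.
have vE t : T <= t -> v t = - K * expR (T - t).
  move=> Tt; have := sol (-1) t n1 Tt; have := xv t Tt.
  by rewrite !mulN1r opprB /K => + h; move: h; lra.
have vcvg : v t @[t --> +oo] --> (0 : R).
  rewrite -[X in _ --> X](mulr0 (- K)).
  apply: (@cvg_trans _ ((- K * expR (T - t)) @[t --> +oo])); last first.
    by apply: cvgM => //; exact: cvg_cst.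
  by apply: near_eq_cvg; near=> t; rewrite vE//; near: t; apply: nbhs_pinfty_ge; exact: num_real.
split=> //; apply/cvg_ex; exists (p - 0).
apply: (@cvg_trans _ ((p - v t) @[t --> +oo])); last by apply: cvgB => //; exact: cvg_cst.
apply: near_eq_cvg; near=> t.
by rewrite -(xv t) ?addrK//; near: t; apply: nbhs_pinfty_ge; exact: num_real.
Unshelve. all: by end_near. Qed.

(** * Construction of an explicit motion *)

Lemma continuous_sumr (R : realType) (T : topologicalType) (n : nat)
    (F : 'I_n -> T -> R) :
  (forall i, continuous (F i)) -> continuous (fun t => \sum_(i < n) F i t).
Proof.
by move=> cF t; apply: cvg_big; [exact: add_continuous|move=> i _; exact: cF].
Qed.

Definition cosh (R : realType) (u : R) : R := (expR u + expR (- u)) / 2.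

Definition sinh (R : realType) (u : R) : R := (expR u - expR (- u)) / 2.

(** Time elapsed since T, frozen at 0 before T: each step then enters the motion through one formula
    valid at all times. *)
Definition ramp (R : realType) (T t : R) : R := Num.max (t - T) 0.

Lemma cosh0 (R : realType) : cosh 0 = 1 :> R.
Proof. by rewrite /cosh oppr0 expR0 divff// pnatr_eq0. Qed.

Lemma sinh0 (R : realType) : sinh 0 = 0 :> R.
Proof. by rewrite /sinh oppr0 expR0 subrr mul0r. Qed.

Lemma is_derive_cosh (R : realType) (u : R) : is_derive u 1 (@cosh R) (sinh u).
Proof.
have -> : @cosh R = 2^-1 \*: (expR + (expR \o -%R)).
  by apply/funext => w; rewrite /cosh mulrC.
have dN : is_derive u 1 (-%R : R -> R) (-1)
  by exact: (is_deriveN (is_derive_id u 1)).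
apply: is_derive_eq; rewrite /GRing.scale/= /sinh; ring.
Qed.

Lemma is_derive_sinh (R : realType) (u : R) : is_derive u 1 (@sinh R) (cosh u).
Proof.
have -> : @sinh R = 2^-1 \*: (expR - (expR \o -%R)).
  by apply/funext => w; rewrite /sinh mulrC.
have dN : is_derive u 1 (-%R : R -> R) (-1)
  by exact: (is_deriveN (is_derive_id u 1)).
apply: is_derive_eq; rewrite /GRing.scale/= /cosh; ring.
Qed.

Lemma continuous_cosh (R : realType) : continuous (@cosh R).
Proof.
move=> u; apply/differentiable_continuous/derivable1_diffP.
by case: (is_derive_cosh u).
Qed.

Lemma continuous_sinh (R : realType) : continuous (@sinh R).
Proof.
move=> u; apply/differentiable_continuous/derivable1_diffP.
by case: (is_derive_sinh u).
Qed.

Lemma continuous_ramp (R : realType) (T : R) : continuous (ramp T).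
Proof.
move=> t; apply: (@continuous_max _ _ (fun t => t - T) (cst 0)); last exact: cvg_cst.
by apply: cvgB; [exact: cvg_id|exact: cvg_cst].
Qed.

Lemma is_derive_ramp (R : realType) (T t : R) :
  t != T -> is_derive t 1 (ramp T) (T < t)%R%:R.
Proof.
rewrite neq_lt => /orP[tT|Tt].
  rewrite (lt_gtF tT); apply: (@near_eq_is_derive _ _ _ (cst 0)).
  near=> u; apply/esym/max_idPr; rewrite subr_le0.
  by apply: ltW; near: u; exact: lt_nbhsl.
rewrite Tt; apply: (@near_eq_is_derive _ _ _ (id - cst T)).
  near=> u; apply/esym/max_idPl; rewrite subr_ge0.
  by apply: ltW; near: u; exact: lt_nbhsr.
by apply: is_derive_eq; rewrite subr0.
Unshelve. all: by end_near. Qed.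

Lemma is_derive_cosh_ramp (R : realType) (T t : R) :
  t != T -> is_derive t 1 (fun u => cosh (ramp T u)) (sinh (ramp T t)).
Proof.
move=> tT; have dC := is_derive_cosh (ramp T t); have dr := is_derive_ramp tT.
apply: is_derive_eq; rewrite /ramp; have [Tt|Tt] := ltP T t; first by rewrite mulr1.
by rewrite (max_idPr _) ?subr_le0// sinh0 mul0r.
Qed.

Lemma is_derive_sinh_ramp (R : realType) (T t : R) : t != T ->
  is_derive t 1 (fun u => sinh (ramp T u)) (cosh (ramp T t) * (T < t)%R%:R).
Proof.
move=> tT; have dS := is_derive_sinh (ramp T t); have dr := is_derive_ramp tT.
exact: is_derive1_comp.
Qed.

(* Moving the stance foot by q at time T subtracts q * (cosh (t - T) - 1) from
   the centre of mass for t >= T and leaves it unchanged before. *)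
Definition lip_com (R : realType) (s : lip_state R) (tau l : seq R) (t : R) : R :=
  stance s + (com s - stance s) * cosh t + vel s * sinh t -
  \sum_(i < size tau) (foothold s l i.+2 - foothold s l i.+1) *
    (cosh (ramp (step_time tau i.+1) t) - 1).

Definition lip_vel (R : realType) (s : lip_state R) (tau l : seq R) (t : R) : R :=
  (com s - stance s) * sinh t + vel s * cosh t -
  \sum_(i < size tau) (foothold s l i.+2 - foothold s l i.+1) *
    sinh (ramp (step_time tau i.+1) t).

(** Here k counts the steps already taken at time t, so one statement serves every bounded phase as
    well as the final unbounded one. *)
Lemma lip_com_vel_dynamics (R : realType) (s : lip_state R) (tau l : seq R)
    (k : nat) (t : R) : (k <= size tau)%N ->
  (forall i, (i < k)%N -> step_time tau i.+1 < t) ->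
  (forall i, (k <= i < size tau)%N -> t < step_time tau i.+1) ->
  is_derive t 1 (lip_com s tau l) (lip_vel s tau l t) /\
  is_derive t 1 (lip_vel s tau l) (lip_com s tau l t - foothold s l k.+1).
Proof.
move=> kn before after.
have tT (i : 'I_(size tau)) : t != step_time tau i.+1.
  have [ik|ki] := ltnP i k; first by rewrite gt_eqF// before.
  by rewrite lt_eqF// after// ki ltn_ord.
have dC (i : 'I_(size tau)) := is_derive_cosh_ramp (tT i).
have dS (i : 'I_(size tau)) := is_derive_sinh_ramp (tT i).
have dc := is_derive_cosh t; have ds := is_derive_sinh t.
pose q i := foothold s l i.+2 - foothold s l i.+1.
split.
  have -> : lip_com s tau l = cst (stance s) + (com s - stance s) \*: @cosh R +
      vel s \*: @sinh R - \sum_(i < size tau)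
        q i \*: ((fun u => cosh (ramp (step_time tau i.+1) u)) - cst 1).
    by apply/funext => u; rewrite /lip_com/= !fctE fct_sumE.
  apply: is_derive_eq; rewrite /lip_vel add0r; congr (_ + _ - _).
  by apply: eq_bigr => i _; rewrite subr0.
have -> : lip_vel s tau l = (com s - stance s) \*: @sinh R + vel s \*: @cosh R -
    \sum_(i < size tau) q i \*: (fun u => sinh (ramp (step_time tau i.+1) u)).
  by apply/funext => u; rewrite /lip_vel/= !fctE fct_sumE.
apply: is_derive_eq; rewrite /lip_com.
(* The jumps of the steps already taken telescope from p_0 to the current foothold. *)
have tele : foothold s l k.+1 = stance s +
    \sum_(i < size tau) q i * (step_time tau i.+1 < t)%R%:R.
  rewrite (bigID (fun i : 'I_ _ => (i < k)%N))/= [X in _ + (_ + X)]big1 ?addr0; last first.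
    by move=> i; rewrite -leqNgt => ki; rewrite lt_gtF ?mulr0// after// ki ltn_ord.
  rewrite (eq_bigr (fun i : 'I_ _ => q i)); last by move=> i ik; rewrite before// mulr1.
  rewrite -(big_ord_widen _ q kn) -(big_mkord xpredT q).
  by rewrite (telescope_sumr (fun i => foothold s l i.+1))//= addrC subrK.
(* For a step already taken, cosh is (cosh - 1) + 1; for a later one the ramp is 0, so cosh - 1 and
   the indicator both vanish. *)
have -> : \sum_(i < size tau) q i *: (cosh (ramp (step_time tau i.+1) t) *
    (step_time tau i.+1 < t)%R%:R) =
  \sum_(i < size tau) q i * (cosh (ramp (step_time tau i.+1) t) - 1) +
  \sum_(i < size tau) q i * (step_time tau i.+1 < t)%R%:R.
  rewrite -big_split/=; apply: eq_bigr => i _; rewrite /GRing.scale/=.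
  have [Tt|Tt] := ltP (step_time tau i.+1) t; first by rewrite /=; ring.
  by rewrite /ramp (max_idPr _) ?subr_le0// cosh0; ring.
rewrite tele /GRing.scale/=; ring.
Qed.

Lemma motion_lip (R : realType) (s : lip_state R) (tau l : seq R) :
  {in tau, forall t, 0 <= t} ->
  motion s tau l (lip_com s tau l) (lip_vel s tau l).
Proof.
move=> tau0; have Tle := step_time_le tau0; have T0 k := step_time_ge0 k tau0.
(* Since every T_k is nonnegative, no step, even one taken at time 0, alters the initial values. *)
have r0 k : ramp (step_time tau k) 0 = 0 by apply/max_idPr; rewrite subr_le0.
split.
- rewrite /lip_com /lip_vel cosh0 sinh0 !big1 => [|i _|i _].
  + by split; ring.
  + by rewrite r0 sinh0 mulr0.
  + by rewrite r0 cosh0 subrr mulr0.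
- split; apply: continuous_subspaceT => t.
    apply: cvgB.
      apply: cvgD; last by apply: cvgM; [exact: cvg_cst|exact: continuous_sinh].
      apply: cvgD; first exact: cvg_cst.
      by apply: cvgM; [exact: cvg_cst|exact: continuous_cosh].
    apply: continuous_sumr => i {}t; apply: cvgM; first exact: cvg_cst.
    apply: cvgB; last exact: cvg_cst.
    by apply: continuous_comp; [exact: continuous_ramp|exact: continuous_cosh].
  apply: cvgB.
    by apply: cvgD; apply: cvgM;
      [exact: cvg_cst|exact: continuous_sinh|exact: cvg_cst|exact: continuous_cosh].
  apply: continuous_sumr => i {}t; apply: cvgM; first exact: cvg_cst.
  by apply: continuous_comp; [exact: continuous_ramp|exact: continuous_sinh].
- move=> k kn t /=; rewrite in_itv/= => /andP[kt tk].
  apply: lip_com_vel_dynamics => [|i ik|i /andP[ki _]]; first exact: ltnW.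
    by rewrite (le_lt_trans _ kt)// Tle.
  by rewrite (lt_le_trans tk)// Tle.
- move=> t /=; rewrite in_itv/= andbT => nt.
  apply: lip_com_vel_dynamics => // [i ik|i]; last by rewrite ltnNge andbN.
  by rewrite (le_lt_trans _ nt)// Tle.
Qed.

(** * Capture as a single equation, for the initial state and after each step *)

(** The discounted capture point at the last step is the same for every motion, which gives the
    direct implication; the converse takes the explicit motion as witness. *)
Lemma captured_byP (R : realType) (s : lip_state R) (tau l : seq R) :
  {in tau, forall t, 0 <= t} ->
  captured_by s tau l <->
  capture_point s + \sum_(j < size tau) foothold s l j.+1 *
    (expR (- step_time tau j.+1) - expR (- step_time tau j)) =
  foothold s l (size tau).+1 * expR (- step_time tau (size tau)).
Proof.
move=> tau0; split=> [[x [v [m v0 xc]]]|eqc].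
  rewrite -(motion_capture_point tau0 m (leqnn _)); congr (_ * _).
  exact/(motion_captured tau0 m).
have m := motion_lip s l tau0; exists (lip_com s tau l), (lip_vel s tau l).
have /(motion_captured tau0 m)[v0 xc] // : lip_com s tau l (step_time tau (size tau)) +
    lip_vel s tau l (step_time tau (size tau)) = foothold s l (size tau).+1.
have /mulIf := lt0r_neq0 (expR_gt0 (- step_time tau (size tau))); apply.
by rewrite (motion_capture_point tau0 m (leqnn _)).
Qed.

Lemma step_time_drop (R : realType) (tau : seq R) (k j : nat) :
  step_time (drop k tau) j = step_time tau (k + j) - step_time tau k.
Proof.
rewrite /step_time big_split_ord/= addrC addrK.
by apply: eq_bigr => i _; rewrite nth_drop.
Qed.

Lemma foothold_state_after_step (R : realType) (s : lip_state R) (tau l : seq R)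
    (x v : R -> R) (k j : nat) :
  foothold (state_after_step s tau l x v k) (drop k l) j = foothold s l (k + j).
Proof.
(* The recursion of [foothold] goes back two indices, so the induction carries two consecutive
   ones. *)
suff [] : foothold (state_after_step s tau l x v k) (drop k l) j =
    foothold s l (k + j) /\
  foothold (state_after_step s tau l x v k) (drop k l) j.+1 =
    foothold s l (k + j).+1 by [].
elim: j => [|j [IH0 IH1]]; first by rewrite addn0.
by rewrite addnS -IH1; split=> //=; rewrite -IH0 nth_drop.
Qed.

(** The capture equation of the remaining steps is that of the whole sequence multiplied by
    exp(T_k): by [motion_capture_point] the first k terms are already contained in the capture point
    at T_k. *)
Lemma captured_by_after_step (R : realType) (s : lip_state R) (tau l : seq R)
    (x v : R -> R) (k : nat) :
  {in tau, forall t, 0 <= t} -> motion s tau l x v -> captured_by s tau l ->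
  (k <= size tau)%N ->
  captured_by (state_after_step s tau l x v k) (drop k tau) (drop k l).
Proof.
move=> tau0 m cap kn; apply/captured_byP => [t /mem_drop/tau0//|].
move/(captured_byP _ _ tau0): cap.
rewrite -(big_mkord xpredT (fun j => foothold s l j.+1 *
    (expR (- step_time tau j.+1) - expR (- step_time tau j)))).
rewrite (big_cat_nat _ kn)// big_mkord addrA -(motion_capture_point tau0 m kn) => total.
rewrite size_drop foothold_state_after_step addnS subnKC// step_time_drop subnKC//.
have E0 := lt0r_neq0 (expR_gt0 (- step_time tau k)).
apply: (mulIf E0).
rewrite mulrDl -mulrA -expRD (_ : _ - _ = - step_time tau (size tau)); last by ring.
rewrite -total; congr (_ + _).
rewrite mulr_suml -[in RHS](add0n k) big_addn big_mkord; apply: eq_bigr => j _.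
rewrite foothold_state_after_step !step_time_drop addnS addnC -mulrA; congr (_ * _).
by rewrite mulrBl -!expRD; congr (expR _ - expR _); ring.
Qed.

(** * From the capture equation to d_N *)

(** The moving foot starts from the previous foothold but one, so the new distance between the feet
    is the step length minus the old distance; unrolling this gives the alternating signs.
    Coinciding feet start the recursion at 0. *)
Lemma foothold_diff (R : realType) (s : lip_state R) (l : seq R) (i : nat) :
  stance s = swing s ->
  foothold s l i.+2 - foothold s l i.+1 =
  \sum_(j < i.+1) (-1) ^+ (i + j) * l`_j.
Proof.
move=> sw; elim: i => [|i IH].
  by rewrite big_ord1 /= expr0 mul1r sw addrC addKr.
have -> : foothold s l i.+3 - foothold s l i.+2 =
    l`_i.+1 - (foothold s l i.+2 - foothold s l i.+1).
  by rewrite -[foothold s l i.+3]/(foothold s l i.+1 + l`_i.+1); ring.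
rewrite IH [RHS]big_ord_recr/= -signr_odd addnn odd_double mul1r addrC; congr (_ + _).
by rewrite -sumrN; apply: eq_bigr => j _; rewrite addSn exprS mulN1r mulNr.
Qed.

Lemma summation_by_parts (R : comRingType) (p E : nat -> R) (n : nat) :
  p n * E n - \sum_(j < n) p j * (E j.+1 - E j) =
  p 0%N * E 0%N + \sum_(i < n) (p i.+1 - p i) * E i.+1.
Proof.
elim: n => [|n IH]; first by rewrite !big_ord0 subr0 addr0.
by rewrite !big_ord_recr/= [RHS]addrA -IH; ring.
Qed.

Lemma captured_by_d (R : realType) (s : lip_state R) (f : R -> R) (N : nat)
    (tau : N.-tuple R) :
  stance s = 0 -> swing s = 0 -> {in tau, forall t, 0 <= t} ->
  captured_by s tau (map f tau) <-> capture_point s = d_ f tau.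
Proof.
move=> st sw tau0.
have -> : d_ f tau = foothold s (map f tau) N.+1 * expR (- step_time tau N) -
    \sum_(j < N) foothold s (map f tau) j.+1 *
      (expR (- step_time tau j.+1) - expR (- step_time tau j)).
  apply/esym/(etrans (summation_by_parts (fun j => foothold s (map f tau) j.+1)
    (fun j => expR (- step_time tau j)) N)).
  (* The boundary term vanishes because p_0 = 0. *)
  rewrite {1}/foothold st mul0r add0r; apply: eq_bigr => i _; congr (_ * _).
  rewrite foothold_diff ?st ?sw//.
  (* The index must stay inside the tuple: past its end the two sides would be the default 0 and f
     0. *)
  apply: eq_bigr => j _; rewrite (nth_map 0)// size_tuple.
  exact: leq_trans (ltn_ord j) (ltn_ord i).
split=> [/(captured_byP s _ tau0)|capd].
  by rewrite size_tuple => <-; rewrite addrK.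
by apply/(captured_byP s _ tau0); rewrite size_tuple capd subrK.
Qed.

(** * Maximum and attained values of d_N *)

(** Clamped arguments never leave [a, b], so continuity relative to the interval yields continuity
    on the whole line. A kernel that is arbitrary outside the interval can thus be exchanged for a
    continuous function with the same values inside. *)
Lemma continuous_clamp (R : realType) (a b : R) (f : R -> R) :
  a <= b -> {within `[a, b], continuous f} ->
  continuous (fun t => f (Num.min (Num.max t a) b)).
Proof.
move=> ab fc t; pose clamp (u : R) := Num.min (Num.max u a) b.
have clab u : `[a, b]%classic (clamp u).
  by rewrite /= in_itv/= le_min le_max ab lexx orbT/= ge_min lexx orbT.
have clc : clamp @ t --> clamp t.
  apply: (@continuous_min _ _ (fun u => Num.max u a) (cst b)); last exact: cvg_cst.
  by apply: (@continuous_max _ _ id (cst a)); [exact: cvg_id|exact: cvg_cst].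
have /subspace_continuousP/(_ _ (clab t)) fct := fc.
move=> U /fct fU.
change (\forall u \near t, U (f (clamp u))).
have fclU : \forall u \near t, `[a, b]%classic (clamp u) -> U (f (clamp u)).
  exact: (clc _ fU).
by apply: filterS fclU => u h; exact: h (clab u).
Qed.

(** Compactness and continuity are taken in the topology of row vectors; this map carries them over
    to tuples of durations. *)
Definition tuple_of_row (R : realType) (N : nat) (v : 'rV[R]_N) : N.-tuple R :=
  [tuple v ord0 i | i < N].

Lemma continuous_tuple_of_row (R : realType) (N j : nat) :
  continuous (fun v : 'rV[R]_N => (tuple_of_row v)`_j).
Proof.
have [jN|Nj] := ltnP j N.
  have -> : (fun v : 'rV[R]_N => (tuple_of_row v)`_j) =
            (fun v : 'rV[R]_N => v ord0 (Ordinal jN)).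
    by apply/funext => v; rewrite (nth_mktuple _ _ (Ordinal jN)).
  exact: coord_continuous.
have -> : (fun v : 'rV[R]_N => (tuple_of_row v)`_j) = cst 0.
  by apply/funext => v; rewrite nth_default// size_tuple.
exact: cst_continuous.
Qed.

Lemma continuous_d (R : realType) (T : topologicalType) (f : R -> R) (N : nat)
    (tau : T -> N.-tuple R) :
  continuous f -> (forall j, continuous (fun v => (tau v)`_j)) ->
  continuous (fun v => d_ f (tau v)).
Proof.
move=> fc cv; apply: continuous_sumr => i v; apply: cvgM.
  apply: continuous_sumr => j {}v; apply: cvgM; first exact: cvg_cst.
  by apply: (@continuous_comp _ _ _ (fun v => (tau v)`_j) f); [exact: cv|exact: fc].
apply: (@continuous_comp _ _ _ (fun v => - \sum_(j < i.+1) (tau v)`_j) expR).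
  by apply: cvgN; apply: continuous_sumr => j; exact: cv.
exact: continuous_expR.
Qed.

Lemma admissible_times_nth (R : realType) (taumax : R) (N : nat) (tau : N.-tuple R) :
  admissible_times taumax tau <-> forall i, 0 <= tnth tau i <= taumax.
Proof.
split=> [adm i|adm t /tnthP[i ->]]; last exact: adm.
exact/adm/mem_tnth.
Qed.

Lemma d_eq_on_admissible (R : realType) (f g : R -> R) (taumax : R) (N : nat)
    (tau : N.-tuple R) :
  {in `[0, taumax], f =1 g} -> admissible_times taumax tau -> d_ f tau = d_ g tau.
Proof.
move=> fg adm; apply: eq_bigr => i _; congr (_ * _).
apply: eq_bigr => j _; rewrite fg// in_itv/=; apply: adm; apply: mem_nth.
rewrite size_tuple; exact: leq_trans (ltn_ord j) (ltn_ord i).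
Qed.

Lemma tuple_of_row_admissible (R : realType) (taumax : R) (N : nat) (v : 'rV[R]_N) :
  admissible_times taumax (tuple_of_row v) <->
  forall i, `[0, taumax]%classic (v ord0 i).
Proof.
rewrite admissible_times_nth; split=> adm i; have := adm i.
  by rewrite tnth_mktuple /= in_itv.
by rewrite tnth_mktuple /= in_itv.
Qed.

Lemma tuple_of_rowK (R : realType) (N : nat) (tau : N.-tuple R) :
  tuple_of_row (\row_i tnth tau i) = tau.
Proof. by apply: eq_from_tnth => i; rewrite tnth_mktuple mxE. Qed.

Lemma d_0 (R : realType) (f : R -> R) (N : nat) :
  f 0 = 0 -> d_ f (tuple_of_row (0 : 'rV[R]_N)) = 0.
Proof.
move=> f0; rewrite /d_ big1// => i _; rewrite big1 ?mul0r// => j _.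
have jN : (j < N)%N by exact: leq_trans (ltn_ord j) (ltn_ord i).
by rewrite (nth_mktuple _ _ (Ordinal jN)) mxE f0 mulr0.
Qed.

Lemma d_max_IVT (R : realType) (f : R -> R) (lmax taumax : R) (N : nat) :
  swing_leg_kernel f lmax taumax ->
  exists2 M : R,
    is_maximum [set d_ f tau |
                 tau in [set tau : N.-tuple R | admissible_times taumax tau]] M &
    forall d, f 0 = 0 -> 0 <= d ->
      (exists2 tau : N.-tuple R, admissible_times taumax tau & d = d_ f tau) <->
      d <= M.
Proof.
move=> [tm0 fc _ _].
(* The maximum is found for the continuous [g] and carried back to [f] through [DE]. *)
pose g t := f (Num.min (Num.max t 0) taumax).
have gc : continuous g by exact: continuous_clamp.
have fg : {in `[0, taumax], f =1 g}.
  by move=> t; rewrite in_itv/= => /andP[t0 tt]; rewrite /g (max_idPl t0) (min_idPl tt).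
pose D (v : 'rV[R]_N) := d_ g (tuple_of_row v).
have Dc : continuous D.
  by apply: continuous_d => // j; exact: continuous_tuple_of_row.
pose A := [set v : 'rV[R]_N | forall i, `[0, taumax]%classic (v ord0 i)].
have A0 : A 0 by move=> i; rewrite /= mxE in_itv/= lexx.
have Ac : compact A.
  by apply: (@rV_compact R N (fun=> `[0, taumax]%classic)) => i; exact: segment_compact.
have [w /set_mem Aw wmax] := compact_EVT_max (ex_intro _ _ A0) Ac
  (continuous_subspaceT Dc).
have DE v : A v -> d_ f (tuple_of_row v) = D v.
  by move=> /tuple_of_row_admissible; exact: d_eq_on_admissible.
have ub (tau : N.-tuple R) : admissible_times taumax tau -> d_ f tau <= D w.
  rewrite -(tuple_of_rowK tau) => /tuple_of_row_admissible Av.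
  by rewrite DE//; apply: wmax; exact: mem_set.
exists (D w) => [|d f0 d0].
  split; last by move=> _ [tau adm <-]; exact: ub.
  by exists (tuple_of_row w); [exact/tuple_of_row_admissible|exact: DE].
split=> [[tau adm ->]|dM]; first exact: ub.
(* The segment runs from the zero tuple, where f 0 = 0 gives the value 0, to the maximizer [w]; d
   lies between the two end values. *)
have pc : continuous (fun u : R => D (u *: w)).
  move=> u; apply: (@continuous_comp _ _ _ (fun u : R => u *: w) D); last exact: Dc.
  exact: scalel_continuous.
have D0 : D 0 = 0 by rewrite -DE// d_0.
have [|u] := @IVT R _ 0 1 d ler01 (continuous_subspaceT pc).
  by rewrite scale0r scale1r D0 ge_min d0 le_max dM orbT.
rewrite in_itv/= => /andP[u0 u1] Du.
(* The box is star-shaped about 0: scaling by u in [0, 1] keeps every duration admissible. *)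
have Auw : A (u *: w).
  move=> i; have := Aw i; rewrite /= mxE !in_itv/= => /andP[w0 wt].
  by rewrite mulr_ge0//= (le_trans _ wt)// ler_piMl.
exists (tuple_of_row (u *: w)); first exact/tuple_of_row_admissible.
by rewrite DE.
Qed.

Theorem corollary4 (R : realType) (N : nat) (f : R -> R) (lmax taumax d : R)
    (s : lip_state R)
    (hN : (1 <= N)%N)
    (hf : swing_leg_kernel f lmax taumax)
    (hcom : com s = 0) (hstance : stance s = 0) (hswing : swing s = 0)
    (hd : capture_point s = d) :
  [/\ N_step_capturable f taumax N s <->
        (exists2 tau : N.-tuple R, admissible_times taumax tau & d = d_ f tau),
      (forall tau : N.-tuple R, admissible_times taumax tau ->
        (d = d_ f tau <-> time_margins f taumax s tau)),
      (forall tau : N.-tuple R, admissible_times taumax tau ->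
        d = d_ f tau -> capture_points s tau (map f tau)) &
      exists2 M : R,
        is_maximum [set d_ f tau |
                     tau in [set tau : N.-tuple R | admissible_times taumax tau]]
          M &
        (f 0 = 0 -> 0 <= d ->
          ((exists2 tau : N.-tuple R,
              admissible_times taumax tau & d = d_ f tau) <-> d <= M))].
Proof.
have adm0 (tau : seq R) : admissible_times taumax tau -> {in tau, forall t, 0 <= t}.
  by move=> adm t /adm/andP[].
have iff (tau : N.-tuple R) : admissible_times taumax tau ->
    (d = d_ f tau <-> time_margins f taumax s tau).
  move=> adm; rewrite -hd; split=> [dE|[_ /captured_by_d]].
    by split=> //; apply/captured_by_d => //; exact: adm0.
  by apply=> //; exact: adm0.
split=> //.
- split=> [[tau tm]|[tau adm dE]]; exists tau.
  + by case: tm.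
  + by apply/iff => //; case: tm.
  + exact/iff.
- move=> tau adm /(iff _ adm)[_ cap].
  (* One motion has to serve for all k at once; along the explicit one, capture by the whole
     sequence passes to the state after each step. *)
  have m := motion_lip s (map f tau) (adm0 _ adm).
  exists (lip_com s tau (map f tau)), (lip_vel s tau (map f tau)); split=> // k /andP[_ kN].
  exact: captured_by_after_step (adm0 _ adm) m cap kN.
have [M maxM dM] := d_max_IVT N hf; exists M => //.
exact: dM.
Qed.
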